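(* If the surfaces $\varphi_e$ and $\varphi_{e_1}$ form a Mannheim surface offset with dual Lorentzian offset angle $\bar\theta$, then the dual radius of curvature $\bar R_1$ of $\varphi_{e_1}$ is given by $$\bar R_1=\cosh\bar\theta.$$
   Context: Minkowski space $\mathbb{R}^3_1$ is $\mathbb{R}^3$ with $\langle \vec a,\vec b\rangle=-a_1b_1+a_2b_2+a_3b_3$, and the Lorentzian cross product is $\vec a\times\vec b=(a_2b_3-a_3b_2,\ a_1b_3-a_3b_1,\ a_2b_1-a_1b_2)$. Dual numbers are $a+\varepsilon a^*$ with $a,a^*\in\mathbb{R}$, $\varepsilon^2=0$; dual vectors are $\vec a+\varepsilon\vec a^*$ with $\vec a,\vec a^*\in\mathbb{R}^3_1$; inner and cross products extend bilinearly over the dual numbers. A differentiable real function $f$ extends to dual numbers by $f(x+\varepsilon x^* )=f(x)+\varepsilon x^*f'(x)$; in particular $\sqrt{x+\varepsilon x^*}=\sqrt x+\varepsilon\frac{x^*}{2\sqrt x}$ for $x>0$, and $|x+\varepsilon x^*|=\operatorname{sgn}(x)(x+\varepsilon x^* )$ for $x\neq0$. First surface (spacelike ruled surface): $\varphi_e(s,v)=\vec c(s)+v\,\vec e(s)$ with smooth $\vec c,\vec e$ on an interval containing $0$, $\langle\vec e,\vec e\rangle=1$, $\langle\vec e\,',\vec e\,'\rangle=-1$, $\langle\vec c\,',\vec e\,'\rangle=0$ (prime is $d/ds$; $s$ is the arc-length of the indicatrix $\vec e$, and $\vec c$ is the striction curve). Put $\vec t=\vec e\,'$, $\vec g=-\vec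 e\times\vec t$; then $\vec t\,'=\vec e+\gamma\vec g$, $\vec g\,'=\gamma\vec t$, which defines the conical curvature $\gamma$. Put $\Delta=\det(\vec c\,',\vec e,\vec t)$, $\delta=\langle\vec c\,',\vec e\rangle$, and $\tilde x=\vec x+\varepsilon\,\vec c\times\vec x$ for $\vec x=\vec e,\vec t,\vec g$. The dual arc-length is $\bar s=s+\varepsilon s^*$, $s^*=\int_0^s\Delta\,du$. The dual Darboux frame $\{\tilde e,\tilde t,\tilde g\}$ satisfies $\frac{d\tilde e}{d\bar s}=\tilde t$, $\frac{d\tilde t}{d\bar s}=\tilde e+\bar\gamma\tilde g$, $\frac{d\tilde g}{d\bar s}=\bar\gamma\tilde t$ with $\bar\gamma=\gamma-\varepsilon(\delta+\gamma\Delta)$. Second surface (timelike ruled surface with timelike rulings): $\varphi_{e_1}(s_1,v)=\vec c_1(s_1)+v\,\vec e_1(s_1)$ with $\langle\vec e_1,\vec e_1\rangle=-1$, $s_1$ the arc-length of the indicatrix $\vec e_1$, $\vec t_1=\frac{d\vec e_1}{ds_1}$ with $\langle\vec t_1,\vec t_1\rangle=1$, $\langle\frac{d\vec c_1}{ds_1},\vec t_1\rangle=0$ ($\vec c_1$ is the striction curve). Put $\Delta_1=\det(\frac{d\vec c_1}{ds_1},\vec e_1,\vec t_1)$ and $\delta_1=\langle\frac{d\vec c_1}{ds_1},\vec e_1\rangle$. Its dual arc-length is $\bar s_1=s_1+\varepsilon s_1^*$, $s_1^*=-\int_0^{s_1}\Delta_1du_1$. Its dual Darboux frame is $\{\tilde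 e_1,\tilde t_1,\tilde g_1\}$, $\tilde x_1=\vec x_1+\varepsilon\,\vec c_1\times\vec x_1$, with $\tilde t_1=\frac{d\tilde e_1}{d\bar s_1}$. Its conical curvature is $\gamma_1=-\langle\frac{d\vec g_1}{ds_1},\vec t_1\rangle$, its dual conical curvature is $\bar\gamma_1=\gamma_1+\varepsilon(\delta_1+\gamma_1\Delta_1)$, and its dual radius of curvature is $\bar R_1=\dfrac{1}{\sqrt{|1-\bar\gamma_1^2|}}$. Mannheim offsets: $\varphi_e$ and $\varphi_{e_1}$ (with corresponding points, $s_1$ being a regular function of $s$, i.e. $\frac{ds_1}{ds}\neq0$) form a Mannheim surface offset if $\tilde g(\bar s)=\tilde t_1(\bar s_1)$. The frames are then related by $$\tilde e_1=\sinh\bar\theta\,\tilde e+\cosh\bar\theta\,\tilde t,\quad \tilde t_1=\tilde g,\quad \tilde g_1=\cosh\bar\theta\,\tilde e+\sinh\bar\theta\,\tilde t,$$ where the dual function $\bar\theta=\theta+\varepsilon\theta^*$ is the dual Lorentzian offset angle; the real functions $\theta$ and $\theta^*$ are called the offset angle and the offset distance. Quantities of the two surfaces are compared at corresponding parameters $s$, $s_1$. *)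

(* Defs.v *)
From Stdlib Require Import Reals Lra.
From Coquelicot Require Import Coquelicot.
Open Scope R_scope.

(** * Minkowski space R^3_1 *)

Record vec := Vec { v1 : R; v2 : R; v3 : R }.

Definition vadd (a b : vec) : vec := Vec (v1 a + v1 b) (v2 a + v2 b) (v3 a + v3 b).
Definition vscal (k : R) (a : vec) : vec := Vec (k * v1 a) (k * v2 a) (k * v3 a).
Definition vopp (a : vec) : vec := Vec (- v1 a) (- v2 a) (- v3 a).

Definition linner (a b : vec) : R := - (v1 a * v1 b) + v2 a * v2 b + v3 a * v3 b.

(** The second component is not that of the Euclidean product, and
    [linner (lcross a b) c = - det3 a b c]. *)
Definition lcross (a b : vec) : vec :=
  Vec (v2 a * v3 b - v3 a * v2 b)
      (v1 a * v3 b - v3 a * v1 b)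
      (v2 a * v1 b - v1 a * v2 b).

Definition det3 (a b c : vec) : R :=
  v1 a * (v2 b * v3 c - v3 b * v2 c)
  - v2 a * (v1 b * v3 c - v3 b * v1 c)
  + v3 a * (v1 b * v2 c - v2 b * v1 c).

Lemma linner_lcross (a b c : vec) : linner (lcross a b) c = - det3 a b c.
Proof. unfold linner, lcross, det3; simpl; ring. Qed.

(** * Dual numbers and dual vectors *)

(** [Dual x y] is x + ε y with ε^2 = 0. *)
Record dual := Dual { dre : R; ddu : R }.

Definition dreal (x : R) : dual := Dual x 0.
Definition dsub (a b : dual) : dual := Dual (dre a - dre b) (ddu a - ddu b).
Definition dmul (a b : dual) : dual :=
  Dual (dre a * dre b) (dre a * ddu b + ddu a * dre b).

(** f(x + ε y) = f(x) + ε y f'(x); meaningful only where f is differentiable. *)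
Definition dext (f : R -> R) (a : dual) : dual :=
  Dual (f (dre a)) (ddu a * Derive f (dre a)).

Definition dinv : dual -> dual := dext Rinv.
Definition dsqrt : dual -> dual := dext sqrt.
Definition dabs : dual -> dual := dext Rabs.
Definition dcosh : dual -> dual := dext cosh.
Definition dsinh : dual -> dual := dext sinh.

Lemma dmul_dinv (a : dual) : dre a <> 0 -> dmul a (dinv a) = dreal 1.
Proof.
intros Ha.
assert (HD : Derive Rinv (dre a) = - / (dre a) ^ 2).
{ apply is_derive_unique; auto_derive; [exact Ha | now field]. }
unfold dmul, dinv, dext, dreal; simpl dre; simpl ddu; rewrite HD.
f_equal; now field.
Qed.

Lemma dsqrtE (x y : R) : 0 < x -> dsqrt (Dual x y) = Dual (sqrt x) (y / (2 * sqrt x)).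
Proof.
intros Hx.
assert (Hs : sqrt x <> 0) by (apply Rgt_not_eq, sqrt_lt_R0, Hx).
assert (HD : Derive sqrt x = / (2 * sqrt x)).
{ apply is_derive_unique; auto_derive; [exact Hx | now field]. }
unfold dsqrt, dext; simpl dre; simpl ddu; rewrite HD; reflexivity.
Qed.

Lemma dabsE (x y : R) : x <> 0 -> dabs (Dual x y) = dmul (dreal (sign x)) (Dual x y).
Proof.
intros Hx.
assert (HD : Derive Rabs x = sign x).
{ apply is_derive_unique.
  generalize (is_derive_Rabs (fun u => u) x 1 (is_derive_id x) Hx).
  change one with 1; now rewrite Rmult_1_r. }
unfold dabs, dext, dmul, dreal; simpl; rewrite HD.
f_equal; [|ring].
destruct (Rtotal_order x 0) as [H|[H|H]]; [|contradiction|].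
- rewrite (sign_eq_m1 _ H), Rabs_left by exact H; ring.
- rewrite (sign_eq_1 _ H), Rabs_right by lra; ring.
Qed.

Lemma dcoshE (x y : R) : dcosh (Dual x y) = Dual (cosh x) (y * sinh x).
Proof.
unfold dcosh, dext; simpl; f_equal; f_equal.
apply is_derive_unique; unfold cosh, sinh; auto_derive; [easy | field].
Qed.

Lemma dsinhE (x y : R) : dsinh (Dual x y) = Dual (sinh x) (y * cosh x).
Proof.
unfold dsinh, dext; simpl; f_equal; f_equal.
apply is_derive_unique; unfold cosh, sinh; auto_derive; [easy | field].
Qed.

(** [DVec a b] is a + ε b. *)
Record dvec := DVec { vre : vec; vdu : vec }.

Definition dvadd (a b : dvec) : dvec := DVec (vadd (vre a) (vre b)) (vadd (vdu a) (vdu b)).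
Definition dvscal (k : dual) (a : dvec) : dvec :=
  DVec (vscal (dre k) (vre a))
       (vadd (vscal (dre k) (vdu a)) (vscal (ddu k) (vre a))).

(** The dual vector x + ε c × x of the line through [c] with direction [x]. *)
Definition dline (c x : vec) : dvec := DVec x (lcross c x).

(** * Smooth curves *)

(** Open intervals, possibly unbounded. *)
Definition in_itv (a b : Rbar) (s : R) : Prop := Rbar_lt a s /\ Rbar_lt s b.

Definition smooth_on (a b : Rbar) (f : R -> R) : Prop :=
  forall (n : nat) (s : R), in_itv a b s -> ex_derive_n f n s.

Definition vsmooth_on (a b : Rbar) (x : R -> vec) : Prop :=
  smooth_on a b (fun s => v1 (x s)) /\
  smooth_on a b (fun s => v2 (x s)) /\
  smooth_on a b (fun s => v3 (x s)).

Definition vderive (x : R -> vec) (s : R) : vec :=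
  Vec (Derive (fun u => v1 (x u)) s)
      (Derive (fun u => v2 (x u)) s)
      (Derive (fun u => v3 (x u)) s).

(** * Ruled surfaces (s, v) |-> c(s) + v e(s) *)

(** The surface is given by its striction curve [c] and its ruling [e],
    parametrized by the arc length of [e]; 0 is the base point of the dual
    arc length. *)
Record spacelike_ruled (a b : Rbar) (c e : R -> vec) : Prop := {
  sr_base : in_itv a b 0;
  sr_smooth_c : vsmooth_on a b c;
  sr_smooth_e : vsmooth_on a b e;
  sr_ruling : forall s, in_itv a b s -> linner (e s) (e s) = 1;
  sr_arclength : forall s, in_itv a b s -> linner (vderive e s) (vderive e s) = -1;
  sr_striction : forall s, in_itv a b s -> linner (vderive c s) (vderive e s) = 0
}.

(** Third vector of the Darboux frame {e, t, g} of a spacelike ruled surface. *)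
Definition central_g (e : R -> vec) (s : R) : vec := vopp (lcross (e s) (vderive e s)).

(** Timelike ruled surface with timelike rulings, together with the third vector
    [g1] of its Darboux frame {e1, t1, g1}. Orthonormality leaves the sign of
    [g1] free; [offset_angle] below fixes it. *)
Record timelike_ruled (a1 b1 : Rbar) (c1 e1 g1 : R -> vec) : Prop := {
  tr_base : in_itv a1 b1 0;
  tr_smooth_c : vsmooth_on a1 b1 c1;
  tr_smooth_e : vsmooth_on a1 b1 e1;
  tr_smooth_g : vsmooth_on a1 b1 g1;
  tr_ruling : forall s1, in_itv a1 b1 s1 -> linner (e1 s1) (e1 s1) = -1;
  tr_arclength : forall s1, in_itv a1 b1 s1 -> linner (vderive e1 s1) (vderive e1 s1) = 1;
  tr_striction : forall s1, in_itv a1 b1 s1 -> linner (vderive c1 s1) (vderive e1 s1) = 0;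
  tr_frame_gg : forall s1, in_itv a1 b1 s1 -> linner (g1 s1) (g1 s1) = 1;
  tr_frame_eg : forall s1, in_itv a1 b1 s1 -> linner (e1 s1) (g1 s1) = 0;
  tr_frame_tg : forall s1, in_itv a1 b1 s1 -> linner (vderive e1 s1) (g1 s1) = 0
}.

Definition Delta1 (c1 e1 : R -> vec) (s1 : R) : R :=
  det3 (vderive c1 s1) (e1 s1) (vderive e1 s1).
Definition delta1 (c1 e1 : R -> vec) (s1 : R) : R :=
  linner (vderive c1 s1) (e1 s1).

Definition conical_curvature1 (e1 g1 : R -> vec) (s1 : R) : R :=
  - linner (vderive g1 s1) (vderive e1 s1).

Definition dual_conical_curvature1 (c1 e1 g1 : R -> vec) (s1 : R) : dual :=
  let gamma1 := conical_curvature1 e1 g1 s1 in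
  Dual gamma1 (delta1 c1 e1 s1 + gamma1 * Delta1 c1 e1 s1).

Definition dual_radius1 (c1 e1 g1 : R -> vec) (s1 : R) : dual :=
  let gb := dual_conical_curvature1 c1 e1 g1 s1 in
  dinv (dsqrt (dabs (dsub (dreal 1) (dmul gb gb)))).

(** * Mannheim offsets *)

(** [sigma] is the change of parameter s |-> s1; dual vectors along the two
    surfaces are compared at corresponding parameters s and [sigma s]. *)
Record mannheim_offset (a b : Rbar) (c e : R -> vec)
    (a1 b1 : Rbar) (c1 e1 : R -> vec) (sigma : R -> R) : Prop := {
  mo_range : forall s, in_itv a b s -> in_itv a1 b1 (sigma s);
  mo_smooth : smooth_on a b sigma;
  mo_regular : forall s, in_itv a b s -> Derive sigma s <> 0;
  mo_frame : forall s, in_itv a b s ->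
    dline (c s) (central_g e s) = dline (c1 (sigma s)) (vderive e1 (sigma s))
}.

(** The relation for t1 is [mo_frame]. The real part of [theta s] is the offset
    angle and its dual part the offset distance. *)
Definition offset_angle (a b : Rbar) (c e c1 e1 g1 : R -> vec)
    (sigma : R -> R) (theta : R -> dual) : Prop :=
  forall s, in_itv a b s ->
    let E := dline (c s) (e s) in
    let T := dline (c s) (vderive e s) in
    dline (c1 (sigma s)) (e1 (sigma s))
      = dvadd (dvscal (dsinh (theta s)) E) (dvscal (dcosh (theta s)) T) /\
    dline (c1 (sigma s)) (g1 (sigma s))
      = dvadd (dvscal (dcosh (theta s)) E) (dvscal (dsinh (theta s)) T).

(* Main.v *)
(** Let [D = c1 o sigma - c]. The dual parts of the frame relations say that
    [D = theta* g], so [<D, e> = <D, t> = 0]. Differentiating the vanishing inner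
    products [<D, e>], [<D, t>], [<e1, g>] and [<g1, g>] along the curve yields, with
    [gamma = <t', g>] and without differentiating [theta] itself,
    [sigma' = gamma cosh theta], [gamma1 = - tanh theta] and
    [delta1 + gamma1 Delta1 = - theta* / cosh^2 theta]: the dual conical curvature
    is [- tanh] of the dual offset angle. *)
Require Import Defs.
From Stdlib Require Import Reals Lra.
From Coquelicot Require Import Coquelicot.
Open Scope R_scope.

(** * Algebra in Minkowski space *)

Definition vsub (x y : vec) : vec := vadd x (vopp y).

Lemma vec_eq (x y : vec) : v1 x = v1 y -> v2 x = v2 y -> v3 x = v3 y -> x = y.
Proof. destruct x, y; simpl; intros; subst; reflexivity. Qed.

Ltac vec_ring :=
  try apply vec_eq; unfold linner, lcross, det3, vsub, vadd, vopp, vscal; simpl; ring.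

Lemma linnerC (x y : vec) : linner x y = linner y x.
Proof. vec_ring. Qed.

Lemma linnerDr (x y z : vec) : linner x (vadd y z) = linner x y + linner x z.
Proof. vec_ring. Qed.

Lemma linnerDl (x y z : vec) : linner (vadd x y) z = linner x z + linner y z.
Proof. vec_ring. Qed.

Lemma linnerZr (k : R) (x y : vec) : linner x (vscal k y) = k * linner x y.
Proof. vec_ring. Qed.

Lemma linnerZl (k : R) (x y : vec) : linner (vscal k x) y = k * linner x y.
Proof. vec_ring. Qed.

Lemma linnerBl (x y z : vec) : linner (vsub x y) z = linner x z - linner y z.
Proof. vec_ring. Qed.

(** The triple product expansion; both signs are opposite to the Euclidean ones. *)
Lemma lcross_lcross (x y z : vec) :
  lcross x (lcross y z) = vsub (vscal (linner x y) z) (vscal (linner x z) y).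
Proof. vec_ring. Qed.

Section Frame.

Variables e t : vec.
Hypothesis ee : linner e e = 1.
Hypothesis tt : linner t t = -1.
Hypothesis et : linner e t = 0.
Let g := vopp (lcross e t).

Lemma frame_eg : linner e g = 0.
Proof. unfold g; vec_ring. Qed.

Lemma frame_tg : linner t g = 0.
Proof. unfold g; vec_ring. Qed.

Lemma frame_gg : linner g g = 1.
Proof.
(* Lorentzian Lagrange identity for the squared length of a cross product. *)
replace (linner g g) with (linner e t ^ 2 - linner e e * linner t t)
  by (unfold g; vec_ring).
rewrite ee, tt, et; ring.
Qed.

Lemma frame_cross_ge : lcross g e = t.
Proof.
transitivity (vsub (vscal (linner e e) t) (vscal (linner e t) e)).
- unfold g; vec_ring.
- rewrite ee, et; vec_ring.
Qed.

Lemma frame_cross_gt : lcross g t = e.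
Proof.
transitivity (vsub (vscal (linner e t) t) (vscal (linner t t) e)).
- unfold g; vec_ring.
- rewrite tt, et; vec_ring.
Qed.

(** Expanding [g × (d × g)] by the triple product formula gives [<d,g> g - <g,g> d]. The left side
    vanishes and [<g,g> = 1]. *)
Lemma parallel_g (d : vec) : lcross d g = Vec 0 0 0 -> d = vscal (linner d g) g.
Proof.
intros H.
assert (K := lcross_lcross g d g).
rewrite H, frame_gg, (linnerC g d) in K.
unfold lcross, vsub, vadd, vopp, vscal in K; simpl in K; injection K; intros.
apply vec_eq; simpl; lra.
Qed.

End Frame.

(** * Differentiation of curves *)

(** Relational companion of [vderive]: the rules below chain through it without separate
    differentiability conditions. *)
Definition vis_derive (x : R -> vec) (s : R) (l : vec) : Prop :=
  is_derive (fun u => v1 (x u)) s (v1 l) /\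
  is_derive (fun u => v2 (x u)) s (v2 l) /\
  is_derive (fun u => v3 (x u)) s (v3 l).

Lemma is_derive_Rplus (f h : R -> R) (s df dh : R) :
  is_derive f s df -> is_derive h s dh -> is_derive (fun u => f u + h u) s (df + dh).
Proof. exact (is_derive_plus f h s df dh). Qed.

Lemma is_derive_Ropp (f : R -> R) (s df : R) :
  is_derive f s df -> is_derive (fun u => - f u) s (- df).
Proof. exact (is_derive_opp f s df). Qed.

Lemma is_derive_Rmult (f h : R -> R) (s df dh : R) :
  is_derive f s df -> is_derive h s dh ->
  is_derive (fun u => f u * h u) s (df * h s + f s * dh).
Proof. intros Hf Hh; exact (is_derive_mult f h s df dh Hf Hh Rmult_comm). Qed.

(** The derivative is left as an existential variable, assembled by the sum, opposite and product
    rules, and only then matched with the expected value by [ring]. *)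
Ltac derive_components :=
  unfold Rminus; evar_last;
  [ repeat lazymatch goal with
    | |- is_derive (fun u => _ + _) _ _ => simple eapply is_derive_Rplus
    | |- is_derive (fun u => - _) _ _ => simple eapply is_derive_Ropp
    | |- is_derive (fun u => _ * _) _ _ => simple eapply is_derive_Rmult
    end; eassumption
  | simpl; ring ].

Lemma is_derive_linner (x y : R -> vec) (s : R) (dx dy : vec) :
  vis_derive x s dx -> vis_derive y s dy ->
  is_derive (fun u => linner (x u) (y u)) s (linner dx (y s) + linner (x s) dy).
Proof.
intros (? & ? & ?) (? & ? & ?); unfold linner; derive_components.
Qed.

Lemma vis_derive_sub (x y : R -> vec) (s : R) (dx dy : vec) :
  vis_derive x s dx -> vis_derive y s dy ->
  vis_derive (fun u => vsub (x u) (y u)) s (vsub dx dy).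
Proof.
intros (? & ? & ?) (? & ? & ?); split; [|split]; simpl; derive_components.
Qed.

Lemma vis_derive_opp_lcross (x y : R -> vec) (s : R) (dx dy : vec) :
  vis_derive x s dx -> vis_derive y s dy ->
  vis_derive (fun u => vopp (lcross (x u) (y u))) s
    (vopp (vadd (lcross dx (y s)) (lcross (x s) dy))).
Proof.
intros (? & ? & ?) (? & ? & ?); split; [|split]; simpl; derive_components.
Qed.

Lemma vis_derive_comp (x : R -> vec) (f : R -> R) (s df : R) (dx : vec) :
  vis_derive x (f s) dx -> is_derive f s df ->
  vis_derive (fun u => x (f u)) s (vscal df dx).
Proof.
intros (H1 & H2 & H3) Hf; split; [|split].
- exact (is_derive_comp (fun u => v1 (x u)) f s _ _ H1 Hf).
- exact (is_derive_comp (fun u => v2 (x u)) f s _ _ H2 Hf).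
- exact (is_derive_comp (fun u => v3 (x u)) f s _ _ H3 Hf).
Qed.

Lemma in_itv_locally (a b : Rbar) (s : R) : in_itv a b s -> locally s (in_itv a b).
Proof.
intros [Ha Hb].
exact (filter_and _ _ (open_Rbar_gt' s a Ha) (open_Rbar_lt' s b Hb)).
Qed.

(** Constancy is known only on the interval; since the interval is open, it is a neighbourhood of
    [s], which is enough for the derivative. *)
Lemma is_derive_const_on (a b : Rbar) (f : R -> R) (k s l : R) :
  (forall u, in_itv a b u -> f u = k) -> in_itv a b s -> is_derive f s l -> l = 0.
Proof.
intros Hf Hs Hl.
assert (H : is_derive f s 0).
{ apply (is_derive_ext_loc (fun _ => k)).
  - apply (filter_imp (in_itv a b)).
    + intros u Hu; symmetry; exact (Hf u Hu).
    + exact (in_itv_locally a b s Hs).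
  - exact (is_derive_const k s). }
rewrite <- (is_derive_unique _ _ _ H); symmetry; exact (is_derive_unique _ _ _ Hl).
Qed.

Lemma linner_const_on (a b : Rbar) (x y : R -> vec) (k s : R) (dx dy : vec) :
  (forall u, in_itv a b u -> linner (x u) (y u) = k) -> in_itv a b s ->
  vis_derive x s dx -> vis_derive y s dy ->
  linner dx (y s) + linner (x s) dy = 0.
Proof.
intros Hk Hs Hx Hy.
exact (is_derive_const_on a b _ k s _ Hk Hs (is_derive_linner x y s dx dy Hx Hy)).
Qed.

Lemma smooth_is_derive (a b : Rbar) (f : R -> R) (s : R) :
  smooth_on a b f -> in_itv a b s -> is_derive f s (Derive f s).
Proof. intros Hf Hs; apply Derive_correct, (Hf 1%nat s Hs). Qed.

Lemma smooth_is_derive2 (a b : Rbar) (f : R -> R) (s : R) :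
  smooth_on a b f -> in_itv a b s -> is_derive (Derive f) s (Derive (Derive f) s).
Proof. intros Hf Hs; apply Derive_correct, (Hf 2%nat s Hs). Qed.

Lemma vsmooth_vis_derive (a b : Rbar) (x : R -> vec) (s : R) :
  vsmooth_on a b x -> in_itv a b s -> vis_derive x s (vderive x s).
Proof.
intros (H1 & H2 & H3) Hs; split; [|split]; simpl; eapply smooth_is_derive; eassumption.
Qed.

Lemma vsmooth_vis_derive2 (a b : Rbar) (x : R -> vec) (s : R) :
  vsmooth_on a b x -> in_itv a b s ->
  vis_derive (vderive x) s (vderive (vderive x) s).
Proof.
intros (H1 & H2 & H3) Hs; split; [|split]; simpl;
  eapply smooth_is_derive2; eassumption.
Qed.

(** * Ruled surfaces and offsets *)

Lemma spacelike_et (a b : Rbar) (c e : R -> vec) (s : R) :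
  spacelike_ruled a b c e -> in_itv a b s -> linner (e s) (vderive e s) = 0.
Proof.
intros H Hs.
assert (De := vsmooth_vis_derive a b e s (sr_smooth_e _ _ _ _ H) Hs).
assert (K := linner_const_on a b e e 1 s _ _ (sr_ruling _ _ _ _ H) Hs De De).
rewrite (linnerC (vderive e s)) in K; lra.
Qed.

Lemma vis_derive_central_g (a b : Rbar) (e : R -> vec) (s : R) :
  vsmooth_on a b e -> in_itv a b s ->
  vis_derive (central_g e) s (vopp (lcross (e s) (vderive (vderive e) s))).
Proof.
intros He Hs.
assert (K := vis_derive_opp_lcross e (vderive e) s _ _
  (vsmooth_vis_derive a b e s He Hs) (vsmooth_vis_derive2 a b e s He Hs)).
(* The product rule also produces [e' × e'], which is zero. *)
replace (vopp (lcross (e s) (vderive (vderive e) s)))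
  with (vopp (vadd (lcross (vderive e s) (vderive e s))
                   (lcross (e s) (vderive (vderive e) s)))) by vec_ring.
exact K.
Qed.

Lemma cosh_pos (x : R) : 0 < cosh x.
Proof. unfold cosh; generalize (exp_pos x) (exp_pos (- x)); lra. Qed.

Lemma cosh2_sinh2 (x : R) : cosh x * cosh x - sinh x * sinh x = 1.
Proof.
assert (H : exp x * exp (- x) = 1) by (rewrite <- exp_plus, Rplus_opp_r; apply exp_0).
unfold cosh, sinh; lra.
Qed.

(** * Geometry of an offset pair, expressed in the frame of the first surface *)

Section Offset.

Variables (a b a1 b1 : Rbar) (c e c1 e1 g1 : R -> vec).
Variables (sigma : R -> R) (theta : R -> dual).
Hypothesis Hphi : spacelike_ruled a b c e.
Hypothesis Hphi1 : timelike_ruled a1 b1 c1 e1 g1.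
Hypothesis Hmannheim : mannheim_offset a b c e a1 b1 c1 e1 sigma.
Hypothesis Hangle : offset_angle a b c e c1 e1 g1 sigma theta.

Let t := vderive e.
Let g := central_g e.
(** Pairing with the unit vector [g] reads off the coefficient in [t' = e + gamma g], so this is the
    conical curvature. *)
Let gamma s := linner (vderive t s) (g s).
Let C s := cosh (dre (theta s)).
Let S s := sinh (dre (theta s)).
Let D s := vsub (c1 (sigma s)) (c s).

Lemma offset_t1 (s : R) : in_itv a b s -> vderive e1 (sigma s) = g s.
Proof.
intros Hs; symmetry.
exact (f_equal vre (mo_frame _ _ _ _ _ _ _ _ _ Hmannheim s Hs)).
Qed.

Lemma offset_e1 (s : R) : in_itv a b s ->
  e1 (sigma s) = vadd (vscal (S s) (e s)) (vscal (C s) (t s)).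
Proof. intros Hs; exact (f_equal vre (proj1 (Hangle s Hs))). Qed.

Lemma offset_g1 (s : R) : in_itv a b s ->
  g1 (sigma s) = vadd (vscal (C s) (e s)) (vscal (S s) (t s)).
Proof. intros Hs; exact (f_equal vre (proj2 (Hangle s Hs))). Qed.

(** The dual part of the relation between [g] and [t1] gives [D × g = 0], so [D] is a multiple of
    [g]. The dual part of the relation for [e1] then fixes the factor. *)
Lemma offset_displacement (s : R) : in_itv a b s ->
  D s = vscal (ddu (theta s)) (g s).
Proof.
intros Hs.
assert (ee := sr_ruling _ _ _ _ Hphi s Hs).
assert (tt := sr_arclength _ _ _ _ Hphi s Hs).
assert (et := spacelike_et _ _ _ _ s Hphi Hs).
assert (Hg : lcross (c s) (g s) = lcross (c1 (sigma s)) (g s)).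
{ rewrite <- (offset_t1 s Hs) at 2.
  exact (f_equal vdu (mo_frame _ _ _ _ _ _ _ _ _ Hmannheim s Hs)). }
assert (HD : D s = vscal (linner (D s) (g s)) (g s)).
{ apply (parallel_g (e s) (t s) ee tt et).
  fold (central_g e s); fold (g s).
  transitivity (vsub (lcross (c1 (sigma s)) (g s)) (lcross (c s) (g s))).
  - unfold D; vec_ring.
  - rewrite Hg; vec_ring. }
(* The dual part of the [e1] relation contains [c × e1]; subtracting it leaves only the terms
   carrying [theta*]. *)
assert (He : lcross (D s) (e1 (sigma s))
             = vscal (ddu (theta s)) (vadd (vscal (C s) (e s)) (vscal (S s) (t s)))).
{ transitivity (vsub (lcross (c1 (sigma s)) (e1 (sigma s))) (lcross (c s) (e1 (sigma s)))).
  - unfold D; vec_ring.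
  - assert (K := proj1 (Hangle s Hs)); cbv zeta in K.
    rewrite (offset_e1 s Hs) in K |- *; unfold C, S, t in K |- *.
    destruct (theta s) as [x y]; rewrite dcoshE, dsinhE in K.
    apply (f_equal vdu) in K; simpl in K |- *; fold t in K |- *.
    rewrite K; vec_ring. }
rewrite HD at 1; f_equal.
(* Since [g × e1 = cosh theta e + sinh theta t], the component of [D × e1] along [e] is
   [<D,g> cosh theta]. *)
apply (Rmult_eq_reg_l (C s)); [|apply Rgt_not_eq, cosh_pos].
transitivity (linner (lcross (D s) (e1 (sigma s))) (e s)).
- rewrite (offset_e1 s Hs); unfold g, central_g; fold t; vec_ring.
- rewrite He, linnerZl, linnerDl, !linnerZl, (linnerC (t s)).
  fold t in et; rewrite ee, et; ring.
Qed.

Lemma offset_speed (s : R) : in_itv a b s -> Derive sigma s = gamma s * C s.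
Proof.
intros Hs.
assert (Hs1 := mo_range _ _ _ _ _ _ _ _ _ Hmannheim s Hs).
assert (Dg := vis_derive_central_g a b e s (sr_smooth_e _ _ _ _ Hphi) Hs).
assert (De1 := vis_derive_comp e1 sigma s _ _
  (vsmooth_vis_derive _ _ _ _ (tr_smooth_e _ _ _ _ _ Hphi1) Hs1)
  (smooth_is_derive _ _ _ _ (mo_smooth _ _ _ _ _ _ _ _ _ Hmannheim) Hs)).
assert (H0 : forall u, in_itv a b u -> linner (e1 (sigma u)) (g u) = 0).
{ intros u Hu; rewrite (offset_e1 u Hu), linnerDl, !linnerZl.
  unfold g, central_g; rewrite frame_eg; fold t; rewrite frame_tg; ring. }
assert (K := linner_const_on _ _ _ _ _ s _ _ H0 Hs De1 Dg).
assert (gg : linner (g s) (g s) = 1).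
{ exact (frame_gg _ _ (sr_ruling _ _ _ _ Hphi s Hs)
    (sr_arclength _ _ _ _ Hphi s Hs) (spacelike_et _ _ _ _ s Hphi Hs)). }
rewrite (offset_t1 s Hs), linnerZl, gg, (offset_e1 s Hs) in K; fold t in K.
(* Only the [t] component contributes: [e × t'] is orthogonal to [e], and its triple product with
   [t] is [gamma] up to sign. *)
assert (E : linner (vadd (vscal (S s) (e s)) (vscal (C s) (t s)))
              (vopp (lcross (e s) (vderive t s))) = - (gamma s * C s)).
{ unfold gamma, g, central_g; fold t; vec_ring. }
lra.
Qed.

(** As [t1 = g], differentiating [<g1,g> = 0] makes the left side equal to [<g1,g'>], where [g']
    pairs to zero with [e] and to [- gamma] with [t]. *)
Lemma offset_conical_curvature (s : R) : in_itv a b s ->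
  Derive sigma s * conical_curvature1 e1 g1 (sigma s) = - (gamma s * S s).
Proof.
intros Hs.
assert (Hs1 := mo_range _ _ _ _ _ _ _ _ _ Hmannheim s Hs).
assert (Dg := vis_derive_central_g a b e s (sr_smooth_e _ _ _ _ Hphi) Hs).
assert (Dg1 := vis_derive_comp g1 sigma s _ _
  (vsmooth_vis_derive _ _ _ _ (tr_smooth_g _ _ _ _ _ Hphi1) Hs1)
  (smooth_is_derive _ _ _ _ (mo_smooth _ _ _ _ _ _ _ _ _ Hmannheim) Hs)).
assert (H0 : forall u, in_itv a b u -> linner (g1 (sigma u)) (g u) = 0).
{ intros u Hu; rewrite (offset_g1 u Hu), linnerDl, !linnerZl.
  unfold g, central_g; rewrite frame_eg; fold t; rewrite frame_tg; ring. }
assert (K := linner_const_on _ _ _ _ _ s _ _ H0 Hs Dg1 Dg).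
unfold conical_curvature1; rewrite (offset_t1 s Hs).
rewrite linnerZl, (offset_g1 s Hs) in K; fold t in K.
assert (E : linner (vadd (vscal (C s) (e s)) (vscal (S s) (t s)))
              (vopp (lcross (e s) (vderive t s))) = - (gamma s * S s)).
{ unfold gamma, g, central_g; fold t; vec_ring. }
lra.
Qed.

Lemma vis_derive_D (s : R) : in_itv a b s ->
  vis_derive D s (vsub (vscal (Derive sigma s) (vderive c1 (sigma s))) (vderive c s)).
Proof.
intros Hs.
assert (Hs1 := mo_range _ _ _ _ _ _ _ _ _ Hmannheim s Hs).
apply (vis_derive_sub (fun u => c1 (sigma u)) c).
- apply vis_derive_comp.
  + exact (vsmooth_vis_derive _ _ _ _ (tr_smooth_c _ _ _ _ _ Hphi1) Hs1).
  + exact (smooth_is_derive _ _ _ _ (mo_smooth _ _ _ _ _ _ _ _ _ Hmannheim) Hs).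
- exact (vsmooth_vis_derive _ _ _ _ (sr_smooth_c _ _ _ _ Hphi) Hs).
Qed.

Lemma offset_striction_e (s : R) : in_itv a b s ->
  Derive sigma s * linner (vderive c1 (sigma s)) (e s) = linner (vderive c s) (e s).
Proof.
intros Hs.
assert (De := vsmooth_vis_derive a b e s (sr_smooth_e _ _ _ _ Hphi) Hs).
assert (H0 : forall u, in_itv a b u -> linner (D u) (e u) = 0).
{ intros u Hu; rewrite (offset_displacement u Hu), linnerZl, linnerC.
  unfold g, central_g; rewrite frame_eg; ring. }
assert (K := linner_const_on _ _ _ _ _ s _ _ H0 Hs (vis_derive_D s Hs) De).
rewrite linnerBl, linnerZl, (offset_displacement s Hs), linnerZl, (linnerC (g s)) in K.
unfold g, central_g in K; rewrite frame_tg in K; lra.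
Qed.

(** Differentiating [<D,t> = 0] leaves [<D,t'> = theta* gamma], because [<c',t>] vanishes on the
    striction curve. *)
Lemma offset_striction_t (s : R) : in_itv a b s ->
  Derive sigma s * linner (vderive c1 (sigma s)) (t s) = - (ddu (theta s) * gamma s).
Proof.
intros Hs.
assert (Dt := vsmooth_vis_derive2 a b e s (sr_smooth_e _ _ _ _ Hphi) Hs).
assert (H0 : forall u, in_itv a b u -> linner (D u) (t u) = 0).
{ intros u Hu; rewrite (offset_displacement u Hu), linnerZl, linnerC.
  unfold g, central_g; fold t; rewrite frame_tg; ring. }
assert (K := linner_const_on _ _ _ _ _ s _ _ H0 Hs (vis_derive_D s Hs) Dt).
fold t in K.
rewrite linnerBl, linnerZl, (offset_displacement s Hs), linnerZl, (linnerC (g s)) in K.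
assert (St := sr_striction _ _ _ _ Hphi s Hs); fold t in St.
fold (gamma s) in K; lra.
Qed.

Lemma offset_delta1 (s : R) :
  in_itv a b s ->
  delta1 c1 e1 (sigma s) = S s * linner (vderive c1 (sigma s)) (e s)
                           + C s * linner (vderive c1 (sigma s)) (t s).
Proof.
intros Hs; unfold delta1; rewrite (offset_e1 s Hs), linnerDr, !linnerZr; reflexivity.
Qed.

Lemma offset_Delta1 (s : R) :
  in_itv a b s ->
  Delta1 c1 e1 (sigma s) = C s * linner (vderive c1 (sigma s)) (e s)
                           + S s * linner (vderive c1 (sigma s)) (t s).
Proof.
intros Hs; unfold Delta1; rewrite (offset_e1 s Hs), (offset_t1 s Hs).
assert (ee := sr_ruling _ _ _ _ Hphi s Hs).
assert (tt := sr_arclength _ _ _ _ Hphi s Hs).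
assert (et := spacelike_et _ _ _ _ s Hphi Hs).
(* On the right side, [e] becomes [g × t] and [t] becomes [g × e]. Both sides are then combinations
   of the same triple products with [c1']. *)
rewrite <- (frame_cross_gt (e s) (t s) tt et) at 2.
rewrite <- (frame_cross_ge (e s) (t s) ee et) at 4.
fold (central_g e s); fold (g s); vec_ring.
Qed.

Lemma offset_dual_conical_curvature (s : R) : in_itv a b s ->
  dual_conical_curvature1 c1 e1 g1 (sigma s)
  = Dual (- (S s / C s)) (- (ddu (theta s) / (C s * C s))).
Proof.
intros Hs.
assert (H0 := mo_regular _ _ _ _ _ _ _ _ _ Hmannheim s Hs).
assert (Hsp := offset_speed s Hs).
assert (HC : C s <> 0) by apply Rgt_not_eq, cosh_pos.
assert (Hga : gamma s <> 0) by (intros E; apply H0; rewrite Hsp, E; ring).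
assert (HCS : C s * C s - S s * S s = 1) by apply cosh2_sinh2.
assert (H1 := offset_conical_curvature s Hs).
assert (He := offset_striction_e s Hs).
assert (Ht := offset_striction_t s Hs).
(* Dividing by [sigma' = gamma cosh theta] cancels [gamma], here and for [Ht']. *)
assert (Hg1 : conical_curvature1 e1 g1 (sigma s) = - (S s / C s)).
{ apply (Rmult_eq_reg_l (Derive sigma s) _ _); [|exact H0].
  rewrite H1, Hsp; field; exact HC. }
assert (Ht' : linner (vderive c1 (sigma s)) (t s) = - (ddu (theta s) / C s)).
{ apply (Rmult_eq_reg_l (Derive sigma s) _ _); [|exact H0].
  rewrite Ht, Hsp; field; exact HC. }
unfold dual_conical_curvature1; simpl; rewrite Hg1; f_equal.
rewrite (offset_delta1 s Hs), (offset_Delta1 s Hs), Ht'.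
(* Inserting the factor [cosh^2 - sinh^2 = 1] turns the goal into an identity of rational functions
   in which [<c1',e>] cancels. *)
replace (- (ddu (theta s) / (C s * C s)))
  with (- (ddu (theta s) / (C s * C s)) * (C s * C s - S s * S s))
  by (rewrite HCS; ring).
field; exact HC.
Qed.

End Offset.

(** * Evaluation of the radius in dual numbers *)

Lemma dinvE (x y : R) : x <> 0 -> dinv (Dual x y) = Dual (/ x) (- (y / (x * x))).
Proof.
intros Hx; unfold dinv, dext; simpl; f_equal.
assert (HD : Derive Rinv x = - / x ^ 2)
  by (apply is_derive_unique; auto_derive; [exact Hx | now field]).
rewrite HD; field; exact Hx.
Qed.

(** Here [gb] is the dual extension of [- tanh], and [1 - tanh^2 = 1 / cosh^2]; the root and the
    inverse then give [cosh]. *)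
Lemma dual_radius_tanh (x y : R) :
  let gb := Dual (- (sinh x / cosh x)) (- (y / (cosh x * cosh x))) in
  dinv (dsqrt (dabs (dsub (dreal 1) (dmul gb gb)))) = dcosh (Dual x y).
Proof.
assert (HC := cosh_pos x).
assert (HC0 : cosh x <> 0) by lra.
assert (HI := Rinv_0_lt_compat _ HC).
set (k := / cosh x) in *.
assert (Hk : k <> 0) by lra.
(* The dual extension of [1 / cosh^2]: its dual part is [y] times the derivative
   [- 2 sinh / cosh^3]. *)
assert (Hd : dsub (dreal 1) (dmul (Dual (- (sinh x / cosh x)) (- (y / (cosh x * cosh x))))
                     (Dual (- (sinh x / cosh x)) (- (y / (cosh x * cosh x)))))
             = Dual (k * k) (- (2 * y * sinh x * (k * (k * k))))).
{ unfold dsub, dmul, dreal; simpl; f_equal; unfold k.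
  - replace 1 with ((cosh x * cosh x - sinh x * sinh x) * 1) at 1
      by (rewrite cosh2_sinh2; ring).
    apply (Rmult_eq_reg_r (cosh x * cosh x)); [|nra].
    transitivity (cosh x * cosh x - sinh x * sinh x).
    + rewrite cosh2_sinh2; field_simplify; [|exact HC0].
      generalize (cosh2_sinh2 x); nra.
    + rewrite cosh2_sinh2; field; exact HC0.
  - field; exact HC0. }
assert (Hkk : 0 < k * k) by (apply Rmult_lt_0_compat; assumption).
(* The real part [k * k] is positive, so the dual absolute value is multiplication by 1. *)
cbv zeta; rewrite Hd, dabsE, (sign_eq_1 _ Hkk) by lra.
replace (dmul _ _) with (Dual (k * k) (- (2 * y * sinh x * (k * (k * k)))))
  by (unfold dmul, dreal; simpl; f_equal; ring).
rewrite dsqrtE, sqrt_square, dinvE, dcoshE by lra.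
f_equal.
- apply Rinv_inv.
- field; exact Hk.
Qed.

Theorem theorem5p8 (a b a1 b1 : Rbar) (c e c1 e1 g1 : R -> vec)
    (sigma : R -> R) (theta : R -> dual)
    (Hphi : spacelike_ruled a b c e)
    (Hphi1 : timelike_ruled a1 b1 c1 e1 g1)
    (Hmannheim : mannheim_offset a b c e a1 b1 c1 e1 sigma)
    (Hangle : offset_angle a b c e c1 e1 g1 sigma theta) :
  forall s : R, in_itv a b s ->
    dual_radius1 c1 e1 g1 (sigma s) = dcosh (theta s).
Proof.
intros s Hs; unfold dual_radius1.
rewrite (offset_dual_conical_curvature a b a1 b1 c e c1 e1 g1 sigma theta
           Hphi Hphi1 Hmannheim Hangle s Hs).
destruct (theta s) as [x y]; apply dual_radius_tanh.
Qed.
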